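(* Let $F$ be a field and let $n\ge 1$ be an integer. The following are equivalent: (1) Every matrix in $\mathbb{M}_n(F)$ is a sum of three idempotents of $\mathbb{M}_n(F)$. (2) Every invertible matrix in $\mathbb{M}_n(F)$ is a sum of three idempotents of $\mathbb{M}_n(F)$. (3) $F\cong \mathbb{Z}_2$ or $F\cong \mathbb{Z}_3$.
   Context: $\mathbb{M}_n(F)$ is the ring of $n\times n$ matrices over $F$. An element $a$ of a ring is an idempotent if $a^2=a$ (so $0$ and $1$ are allowed, and the three idempotents need not be distinct). $\mathbb{Z}_k$ denotes the ring of integers modulo $k$. *)

(* Defs.v *)
From HB Require Import structures.
From mathcomp Require Import all_boot all_order all_algebra.

Set Implicit Arguments.
Unset Strict Implicit.
Unset Printing Implicit Defensive.

Import GRing.Theory.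
Local Open Scope ring_scope.

Definition is_idempotent (R : pzRingType) (e : R) : Prop := e * e = e.

Definition sum_of_three_idempotents (R : pzRingType) (a : R) : Prop :=
  exists e1 e2 e3 : R,
    [/\ is_idempotent e1, is_idempotent e2, is_idempotent e3
      & a = e1 + e2 + e3].

Definition ring_isomorphic (R S : pzRingType) : Prop :=
  exists f : {rmorphism R -> S}, bijective f.

(* Main.v *)
(* (3) => (1): A is the direct sum of a cyclic matrix and a smaller one.  A cyclic
   matrix is similar to one with 1's just above the diagonal, zeros elsewhere
   outside the last row, and prescribed diagonal entries except for the last,
   which is fixed by the trace.  With diagonal entries 1 or 2 the rows can be
   shared out so that each summand has an identity block on its nonzero rows,
   which makes it idempotent.

   (2) => (3): writing g = 1 - 2 e turns three idempotents of sum A into three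
   involutions of sum 3 - 2 A, which is impossible for a suitable invertible A
   unless the characteristic is 2 or 3.  The trace of an idempotent is then the
   image of a natural number, hence so is every element x of F, up to a natural
   number the trace of diag(x, 1, ..., 1). *)
Require Import Defs.
From HB Require Import structures.
From mathcomp Require Import all_boot all_order all_algebra.
From mathcomp Require Import perm ring zify.

Set Implicit Arguments.
Unset Strict Implicit.
Unset Printing Implicit Defensive.

Import GRing.Theory.
Local Open Scope ring_scope.

Section SumOfThree.

Variable F : fieldType.

(** * Transposition, direct sums and conjugation *)

Lemma sum3_tr n (A : 'M[F]_n) :
  sum_of_three_idempotents A^T -> sum_of_three_idempotents A.
Proof.
have trI (e : 'M[F]_n) : is_idempotent e -> is_idempotent e^T.
  by rewrite /is_idempotent => ee; rewrite -[RHS](congr1 trmx ee) [RHS]trmx_mul.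
case=> e1 [e2 [e3 [/trI i1 /trI i2 /trI i3 AE]]].
by exists e1^T, e2^T, e3^T; split=> //; rewrite -[A]trmxK AE !linearD.
Qed.

(** [Q' *m Q] and [R' *m R] are complementary projections commuting with [A], so idempotents summing
    to the two compressions of [A] glue together. Factored projections avoid splitting the size [n]
    into blocks. *)
Lemma sum3_split n k r (A : 'M[F]_n) (Q : 'M_(k, n)) (Q' : 'M_(n, k))
    (R : 'M_(r, n)) (R' : 'M_(n, r)) :
  Q *m Q' = 1%:M -> R *m R' = 1%:M -> Q' *m Q + R' *m R = 1%:M ->
  A *m (Q' *m Q) = Q' *m Q *m A ->
  sum_of_three_idempotents (Q *m A *m Q') ->
  sum_of_three_idempotents (R *m A *m R') ->
  sum_of_three_idempotents A.
Proof.
move=> QQ RR QR1 cA [a1 [a2 [a3 [ia1 ia2 ia3 aE]]]] [b1 [b2 [b3 [ib1 ib2 ib3 bE]]]].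
have QR0 : Q *m R' = 0.
  have : Q *m (Q' *m Q + R' *m R) *m R' = Q *m R' by rewrite QR1 mulmx1.
  rewrite mulmxDr mulmxDl !mulmxA QQ mul1mx -!mulmxA RR mulmx1.
  by rewrite -[X in _ = X -> _]addr0 => /addrI.
have RQ0 : R *m Q' = 0.
  have : R *m (Q' *m Q + R' *m R) *m Q' = R *m Q' by rewrite QR1 mulmx1.
  rewrite mulmxDr mulmxDl !mulmxA RR mul1mx -!mulmxA QQ mulmx1.
  by rewrite -[X in _ = X -> _]add0r => /addIr.
pose j a b : 'M_n := Q' *m a *m Q + R' *m b *m R.
have ji a b : is_idempotent a -> is_idempotent b -> is_idempotent (j a b).
  rewrite /is_idempotent => ia ib.
  change (j a b *m j a b = j a b); change (a *m a = a) in ia; change (b *m b = b) in ib.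
  rewrite /j mulmxDl !mulmxDr !mulmxA.
  rewrite -(mulmxA _ Q Q') -(mulmxA _ R R') -(mulmxA _ Q R') -(mulmxA _ R Q').
  by rewrite QQ RR QR0 RQ0 !mulmx1 !mulmx0 !mul0mx addr0 add0r -(mulmxA _ a a) -(mulmxA _ b b) ia ib.
exists (j a1 b1), (j a2 b2), (j a3 b3); split; [exact: ji.. |].
have -> : j a1 b1 + j a2 b2 + j a3 b3 = j (a1 + a2 + a3) (b1 + b2 + b3).
  by rewrite /j !mulmxDr !mulmxDl (addrACA _ _ (Q' *m a2 *m Q)) (addrACA _ _ (Q' *m a3 *m Q)).
rewrite -aE -bE /j.
have cA' : A *m (R' *m R) = R' *m R *m A.
  have -> : R' *m R = 1%:M - Q' *m Q by rewrite -QR1 [X in X - _]addrC addrK.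
  by rewrite mulmxBr mulmxBl cA mulmx1 mul1mx.
have -> : Q' *m (Q *m A *m Q') *m Q = A *m (Q' *m Q).
  rewrite !mulmxA -cA -!mulmxA; congr (_ *m (_ *m _)).
  by rewrite mulmxA QQ mul1mx.
have -> : R' *m (R *m A *m R') *m R = A *m (R' *m R).
  rewrite !mulmxA -cA' -!mulmxA; congr (_ *m (_ *m _)).
  by rewrite mulmxA RR mul1mx.
by rewrite -mulmxDr QR1 mulmx1.
Qed.

Lemma sum3_conj n (A S : 'M[F]_n) :
  S \in unitmx -> sum_of_three_idempotents (S *m A *m invmx S) ->
  sum_of_three_idempotents A.
Proof.
move=> Su sA.
apply: (@sum3_split _ _ 0 A S (invmx S) 0 0) => //.
- exact: mulmxV.
- by rewrite !flatmx0.
- by rewrite mulVmx // mul0mx addr0.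
- by rewrite mulVmx // mulmx1 mul1mx.
- by exists 0, 0, 0; split; rewrite /is_idempotent [LHS]flatmx0 [RHS]flatmx0.
Qed.

(** With [L] a left inverse of [col_base e] and [P] a right inverse of [row_base e], this is
    [L *m (e *m e) *m P = L *m e *m P]. *)
Lemma idempotent_bases n (e : 'M[F]_n) :
  e *m e = e -> row_base e *m col_base e = 1%:M.
Proof.
move=> ee; have [L LC] := row_fullP (col_base_full e).
have [P RP] := row_freeP (row_base_free e).
have eE := mulmx_base e.
have LE : L *m e = row_base e by apply: etrans (congr1 (mulmx L) (esym eE)) _; rewrite mulmxA LC mul1mx.
have EP : e *m P = col_base e by apply: etrans (congr1 (mulmx^~ P) (esym eE)) _; rewrite -mulmxA RP mulmx1.
by rewrite -LE -[X in _ *m X]EP !mulmxA -(mulmxA L) ee LE RP.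
Qed.

(** * Idempotents on selected rows and Hessenberg matrices *)

(** Entries in columns outside [c] are free: in [e *m e] they only meet zero rows. *)
Lemma row_selection_idempotent k (c : pred 'I_k) (e : 'M[F]_k) :
  (forall i j, ~~ c i -> e i j = 0) ->
  (forall i j, c i -> c j -> e i j = (i == j)%:R) ->
  is_idempotent e.
Proof.
move=> e0 e1; apply/matrixP=> i j; rewrite [LHS]mxE.
have [ci|nci] := boolP (c i); last first.
  by rewrite e0 // big1 // => l _; rewrite e0 // mul0r.
rewrite (bigD1 i) //= e1 // eqxx mul1r big1 ?addr0 // => l li.
have [cl|ncl] := boolP (c l); last by rewrite (e0 l) // mulr0.
by rewrite e1 // eq_sym (negPf li) mul0r.
Qed.

(* Rows are distributed according to the parity of their index, so that the 1's
   above the diagonal never link two rows of the same summand; the last row,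
   over which there is no control, is a summand of its own. *)
Lemma hessenberg_sum3_ones k (M : 'M[F]_k.+1) :
  (forall i j : 'I_k.+1, (i < k)%N -> M i j = (i == j)%:R + (j == i.+1 :> nat)%:R) ->
  M ord_max ord_max = 1 -> sum_of_three_idempotents M.
Proof.
move=> MH Ml.
pose p (b : nat) (i : 'I_k.+1) := if b is b'.+1 then (i < k)%N && (odd i == odd b') else (i == k :> nat).
pose e b : 'M[F]_k.+1 := \matrix_(i, j) (if p b i then M i j else 0).
have ei b : is_idempotent (e b).
  apply: (row_selection_idempotent (c := p b)) => i j; first by rewrite mxE => /negPf->.
  rewrite mxE => pi; rewrite pi; case: b pi => [|b] /=.
    move=> ik jk.
    have -> : i = ord_max by apply/val_inj/eqP.
    have -> : j = ord_max by apply/val_inj/eqP.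
    by rewrite eqxx.
  move=> /andP[ik io] /andP[jk jo]; rewrite MH //.
  have -> : (j == i.+1 :> nat) = false by lia.
  by rewrite addr0.
exists (e 0), (e 1), (e 2); split; try exact: ei.
apply/matrixP=> i j; rewrite !mxE /=.
have := ltn_ord i; rewrite ltnS leq_eqVlt; case: ltngtP => //= ik _.
  by case: (odd i); rewrite ?add0r ?addr0.
by rewrite !addr0.
Qed.

(* The last row keeps a 1 on the diagonal in both e1 and e3; its other entries are
   split between them by the parity of the column, which leaves room in e3 for
   one more diagonal entry, just above, when s is true. *)
Lemma hessenberg_sum3_twos k (s : bool) (M : 'M[F]_k.+1) :
  (forall i j : 'I_k.+1, (i < k)%N ->
     M i j = (i == j)%:R + (s && (i.+1 == k) && (i == j))%:R + (j == i.+1 :> nat)%:R) ->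
  M ord_max ord_max = 2 -> sum_of_three_idempotents M.
Proof.
move=> MH Ml.
(* Parity is counted from the last row, so the row just above it always falls in [e2], where its
   diagonal entry is brought back to 1; [e3] takes the excess. *)
pose e1 : 'M[F]_k.+1 := \matrix_(i, j)
  if odd (i + k) then 0
  else if i == k :> nat then
    if j == k :> nat then 1 else if odd (j + k) then M i j else 0
  else M i j.
pose e2 : 'M[F]_k.+1 := \matrix_(i, j)
  if odd (i + k) then M i j - (s && (i.+1 == k) && (i == j))%:R else 0.
pose e3 : 'M[F]_k.+1 := \matrix_(i, j)
  if i == k :> nat then
    if j == k :> nat then 1 else if odd (j + k) then 0 else M i j
  else (s && (i.+1 == k) && (i == j))%:R.
have lt_k (i : 'I_k.+1) : (i == k :> nat) = false -> (i < k)%N by have := ltn_ord i; lia.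
have eq_k (i : 'I_k.+1) : (i == k :> nat) -> i = ord_max by move=> ik; apply/val_inj/eqP.
exists e1, e2, e3; split.
- apply: (row_selection_idempotent (c := fun i : 'I__ => ~~ odd (i + k))) => i j.
    by rewrite mxE negbK => ->.
  rewrite mxE => io jo; rewrite (negPf io) (negPf jo).
  case: (boolP (i == k :> nat)) => [/eq_k ->|/negbTE ik].
    by rewrite -val_eqE /= eq_sym; case: eqP.
  rewrite MH ?lt_k //.
  have -> : (j == i.+1 :> nat) = false by lia.
  have -> : (i.+1 == k :> nat) = false by lia.
  by rewrite andbF !addr0.
- apply: (row_selection_idempotent (c := fun i : 'I__ => odd (i + k))) => i j.
    by rewrite mxE => /negPf->.
  rewrite mxE => io jo; rewrite io.
  rewrite MH; last by have := ltn_ord i; lia.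
  have -> : (j == i.+1 :> nat) = false by lia.
  by rewrite addr0 addrK.
- apply: (row_selection_idempotent
    (c := fun i : 'I__ => (i == k :> nat) || s && (i.+1 == k))) => i j.
    by rewrite mxE negb_or => /andP[/negPf-> /negPf->].
  rewrite mxE; case: (boolP (i == k :> nat)) => [/eq_k -> _|/negbTE ik /= si].
    rewrite -val_eqE /= [k == _]eq_sym; case: eqP => //= _ /andP[_ /eqP jk].
    by have -> : odd (j + k) by lia.
  by rewrite si.
- apply/matrixP=> i j; rewrite !mxE.
  case: (boolP (i == k :> nat)) => [/eq_k -> /=|/negbTE ik].
    have -> : odd (k + k) = false by lia.
    case: (boolP (j == k :> nat)) => [/eq_k -> |_]; first by rewrite Ml; ring.
    by case: odd; rewrite ?addr0 ?add0r.
  case: (boolP (odd (i + k))) => io; first by rewrite add0r subrK.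
  have -> : (i.+1 == k :> nat) = false by lia.
  by rewrite andbF !addr0.
Qed.

(** * Krylov families and cyclic matrices *)

Definition krylov n (A : 'M[F]_n) (v : 'rV_n) k : 'M_(k, n) :=
  \matrix_(i < k) (v *m A ^+ i).

(** The longer family spans both [X] and [X *m A], hence a space strictly larger than that of
    [X]. *)
Lemma krylov_grow n (A : 'M[F]_n) v k :
  row_free (krylov A v k) -> ~~ (krylov A v k *m A <= krylov A v k)%MS ->
  row_free (krylov A v k.+1).
Proof.
set X := krylov A v k; set X1 := krylov A v k.+1 => /eqP rX nst.
have sX : (X <= X1)%MS.
  apply/row_subP=> i; rewrite rowK.
  rewrite (_ : v *m A ^+ i = row (widen_ord (leqnSn k) i) X1) ?row_sub //.
  by rewrite rowK.
have sXA : (X *m A <= X1)%MS.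
  apply/row_subP=> i; rewrite row_mul rowK -mulmxA.
  have -> : A ^+ i *m A = A ^+ i.+1 by rewrite exprSr.
  rewrite (_ : v *m A ^+ i.+1 = row (lift ord0 i) X1) ?row_sub //.
  by rewrite rowK.
have lt : (X < X + X *m A)%MS.
  by rewrite ltmxE addsmxSl /= addsmx_sub submx_refl.
rewrite /row_free eqn_leq rank_leq_row.
apply: leq_trans (mxrankS (_ : (X + X *m A <= X1)%MS)); last by rewrite addsmx_sub sX.
by rewrite -[k in (k < _)%N]rX; apply: rank_ltmx.
Qed.

(** The basis is v, v(C - d_0), v(C - d_0)(C - d_1), and so on. The last row stays uncontrolled
    because the next vector lies outside the basis. *)
Lemma cyclic_hessenberg k (C : 'M[F]_k.+1) v (d : nat -> F) :
  row_free (krylov C v k.+1) ->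
  exists2 S, S \in unitmx &
    forall i j : 'I_k.+1, (i < k)%N ->
      (S *m C *m invmx S) i j = d i * (i == j)%:R + (j == i.+1 :> nat)%:R.
Proof.
move=> free.
pose b := fix b i := if i is i'.+1 then b i' *m (C - (d i')%:M) else v.
have bC i : b i *m C = d i *: b i + b i.+1.
  by rewrite /= mulmxBr mul_mx_scalar addrC subrK.
pose S : 'M_k.+1 := \matrix_(i < k.+1) b i.
(* For [i = 0] this puts the Krylov family in the row space of [S], which is therefore
   invertible. *)
have bS (i m : nat) : (i + m < k.+1)%N -> (b i *m C ^+ m <= S)%MS.
  elim: m i => [|m IH] i lt.
    rewrite expr0 mulmx1; rewrite addn0 in lt.
    by rewrite (_ : b i = row (Ordinal lt) S) ?row_sub ?rowK.
  have -> : C ^+ m.+1 = C *m C ^+ m by rewrite exprS.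
  rewrite mulmxA bC mulmxDl -scalemxAl addmx_sub ?scalemx_sub ?IH //; lia.
have Su : S \in unitmx.
  rewrite -row_free_unit /row_free eqn_leq rank_leq_row -[X in (X <= _)%N](eqP free) mxrankS //.
  by apply/row_subP=> i; rewrite rowK; exact: (bS 0%N i (ltn_ord i)).
exists S => // i j ik.
have -> : (S *m C *m invmx S) i j = (row i (S *m C *m invmx S)) 0 j by rewrite [RHS]mxE.
have ik1 : (i.+1 < k.+1)%N by [].
rewrite -mulmxA row_mul rowK mulmxA bC.
have -> : b i = delta_mx 0 i *m S by rewrite -rowE rowK.
have -> : b i.+1 = delta_mx 0 (Ordinal ik1) *m S by rewrite -rowE rowK.
rewrite scalemxAl -mulmxDl -mulmxA mulmxV // mulmx1 !mxE eqxx /=.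
by rewrite [j == i]eq_sym -[j == Ordinal _]val_eqE.
Qed.

Lemma cyclic_sum3 k (C : 'M[F]_k.+1) v :
  (forall x : F, [\/ x = 0, x = 1 | x = 2]) ->
  row_free (krylov C v k.+1) -> sum_of_three_idempotents C.
Proof.
move=> F3 free.
case: k C v free => [|k] C v free.
  rewrite [C]mx11_scalar.
  have i0 : is_idempotent (0 : 'M[F]_1) by rewrite /is_idempotent mul0r.
  have i1 : is_idempotent (1%:M : 'M[F]_1) by exact: mulmx1.
  case: (F3 (C 0 0)) => ->.
  - by exists 0, 0, 0; split; rewrite // !addr0 raddf0.
  - by exists 1%:M, 0, 0; split; rewrite // !addr0.
  - exists 1%:M, 1%:M, 0; split=> //.
    by rewrite addr0 -raddfD.
(* Diagonal entries 1 leave [t + 1] in the corner. This is 1 or 2 for [t = 0] or [t = 1]; for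
   [t = 2], a 2 just above the corner brings it down to 2. *)
pose t := \tr C - k.+2%:R.
have H (s : bool) : exists2 S, S \in unitmx & let M := S *m C *m invmx S in
    (forall i j : 'I_k.+2, (i < k.+1)%N -> M i j =
       (i == j)%:R + (s && (i.+1 == k.+1) && (i == j))%:R + (j == i.+1 :> nat)%:R)
    /\ M ord_max ord_max = t + 1 - s%:R.
  have [S Su SE] := cyclic_hessenberg (fun i => 1 + (s && (i.+1 == k.+1))%:R) free.
  exists S => //=; move: SE; set M := S *m C *m invmx S => ME.
  have ME' (i j : 'I_k.+2) : (i < k.+1)%N -> M i j =
       (i == j)%:R + (s && (i.+1 == k.+1) && (i == j))%:R + (j == i.+1 :> nat)%:R.
    by move/ME->; rewrite mulrDl mul1r -natrM mulnb.
  split=> //; rewrite /t (_ : \tr C = \tr M); last first.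
    by rewrite [RHS]mxtrace_mulC mulmxA mulVmx // mul1mx.
  rewrite /mxtrace big_ord_recr /= (eq_bigr (fun i : 'I_k.+1 => 1 + (s && (i == ord_max))%:R)); last first.
    move=> i _; rewrite ME' /= ?ltn_ord // eqxx andbT eqSS -val_eqE /=.
    by rewrite (_ : (i == i.+1 :> nat) = false) ?addr0 //; lia.
  rewrite big_split /= sumr_const card_ord (bigD1 ord_max) //= eqxx andbT big1; last first.
    by move=> i /negPf->; rewrite andbF.
  by rewrite (natrD _ 1 k.+1) /=; ring.
case: (F3 t) H => -> H.
- have [S Su [SE Sl]] := H false; apply: (sum3_conj Su); apply: hessenberg_sum3_ones.
    by move=> i j /SE->; rewrite addr0.
  by rewrite Sl add0r subr0.
- have [S Su [SE Sl]] := H false; apply: (sum3_conj Su).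
  by apply: (hessenberg_sum3_twos (s := false)) => //; rewrite Sl subr0.
- have [S Su [SE Sl]] := H true; apply: (sum3_conj Su).
  by apply: (hessenberg_sum3_twos (s := true)) => //; rewrite Sl addrK.
Qed.

(** Reversing the columns gives a lower triangular matrix with 1's on the diagonal. *)
Lemma unitmx_antitriangular k (H : 'M[F]_k.+1) :
  (forall i j : 'I_k.+1, (i + j < k)%N -> H i j = 0) ->
  (forall i j : 'I_k.+1, (i + j = k)%N -> H i j = 1) -> H \in unitmx.
Proof.
move=> H0 H1; pose s := perm (@rev_ord_inj k.+1).
suff: col_perm s H \in unitmx by rewrite col_permE unitmx_mul => /andP[].
rewrite unitmxE det_trig; last first.
  by apply/is_trig_mxP=> i j ij; rewrite mxE permE H0 //=; have := ltn_ord j; lia.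
by rewrite big1 ?unitr1 // => i _; rewrite mxE permE H1 //=; have := ltn_ord i; lia.
Qed.

(* Induction on n - k: a Krylov family of k + 1 vectors that spans no invariant
   subspace, for A or for its transpose, can be extended.  Otherwise the families
   X (of A) and Z (of A^T) are dual up to the invertible Hankel matrix X Z^T, and
   Z^T (X Z^T)^-1 X is a projection commuting with A. *)
Lemma krylov_sum3 n (A : 'M[F]_n) v k j :
  (forall x : F, [\/ x = 0, x = 1 | x = 2]) ->
  (forall r (B : 'M[F]_r), (r < n)%N -> sum_of_three_idempotents B) ->
  (n < k.+1 + j)%N -> row_free (krylov A v k.+1) -> sum_of_three_idempotents A.
Proof.
move=> F3 IHn; elim: j => [|j IHj] in A v k *; set X := krylov A v k.+1.
  rewrite addn0 => lt /eqP rX; have := rank_leq_col X.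
  by rewrite rX leqNgt lt.
rewrite addnS -addSn => lt fX.
have [|nst] := boolP (X *m A <= X)%MS; last exact: IHj lt (krylov_grow fX nst).
case/submxP=> C XA.
have XAn (i : nat) : X *m A ^+ i = C ^+ i *m X.
  elim: i => [|i IH]; first by rewrite !expr0 [LHS]mulmx1 [RHS]mul1mx.
  have -> : A ^+ i.+1 = A ^+ i *m A by rewrite exprSr.
  have -> : C ^+ i.+1 = C ^+ i *m C by rewrite exprSr.
  by rewrite mulmxA IH -mulmxA XA mulmxA.
have [P XP] := row_freeP fX.
(* [f] is dual to the last vector of [X], so the Hankel matrix [X *m Z^T] is antitriangular with 1's
   on its antidiagonal. *)
pose f : 'cV_n := P *m delta_mx ord_max 0.
pose Z := krylov A^T f^T k.+1.
have ZE (i : 'I_k.+1) : row i Z = (A ^+ i *m f)^T.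
  rewrite rowK [RHS]trmx_mul; congr (_ *m _).
  elim: (i : nat) => [|m IH]; first by rewrite !expr0; exact: esym (trmx1 _ _).
  rewrite exprSr exprS; change (A^T ^+ m *m A^T = (A *m A ^+ m)^T).
  by rewrite IH trmx_mul.
have HE (i l : 'I_k.+1) : (X *m Z^T) i l = (v *m A ^+ (i + l) *m f) 0 0.
  have -> : (X *m Z^T) i l = (row i X *m (row l Z)^T) 0 0.
    by rewrite !mxE; apply: eq_bigr => m _; rewrite !mxE.
  rewrite ZE trmxK rowK; have -> : A ^+ (i + l) = A ^+ i *m A ^+ l by rewrite exprD.
  by rewrite !mulmxA.
have vf (m : 'I_k.+1) : (v *m A ^+ m *m f) 0 0 = (m == ord_max)%:R.
  have -> : v *m A ^+ m = row m X by rewrite rowK.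
  by rewrite /f mulmxA -row_mul XP -row_mul mul1mx !mxE eqxx andbT.
have Hu : X *m Z^T \in unitmx.
  apply: unitmx_antitriangular => i l ij; rewrite HE.
    have ijk : (i + l < k.+1)%N by lia.
    by have := vf (Ordinal ijk); rewrite -val_eqE /= ltn_eqF.
  by have := vf ord_max; rewrite /= eqxx ij.
have fZ : row_free Z.
  apply/row_freeP; exists (X^T *m invmx (X *m Z^T)^T).
  have ZX : (X *m Z^T)^T = Z *m X^T by rewrite trmx_mul trmxK.
  by rewrite mulmxA -ZX mulmxV // unitmx_tr.
have [|nst] := boolP (Z *m A^T <= Z)%MS; last first.
  by apply: sum3_tr; exact: IHj lt (krylov_grow fZ nst).
case/submxP=> D /(congr1 trmx); rewrite !trmx_mul trmxK => AZ.
set H := X *m Z^T in Hu.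
(* Both sides are [X *m A *m Z^T]; hence [Q'] intertwines [A] and [C]. *)
have CH : C *m H = H *m D^T by rewrite /H mulmxA -XA -!mulmxA AZ.
pose Q' := Z^T *m invmx H.
have QQ : X *m Q' = 1%:M by rewrite /Q' mulmxA mulmxV.
have AQ : A *m Q' = Q' *m C.
  rewrite /Q' mulmxA AZ -!mulmxA; congr (_ *m _).
  by apply: (can_inj (mulKmx Hu)); rewrite mulKVmx // mulmxA -CH mulmxK.
have cA : A *m (Q' *m X) = Q' *m X *m A by rewrite mulmxA AQ -!mulmxA XA.
pose e := 1%:M - Q' *m X.
have ee : e *m e = e.
  rewrite /e mulmxBl mulmxBr !mulmxBr !mul1mx mulmx1.
  by rewrite (mulmxA _ Q') -(mulmxA Q' X) QQ mulmx1 subrr subr0.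
have Xe : X *m e = 0 by rewrite /e mulmxBr mulmx1 mulmxA QQ mul1mx subrr.
have re : (\rank e < n)%N.
  rewrite ltn_neqAle rank_leq_row andbT; apply/negP=> re.
  have /row_freeP[B eB] : row_free e by exact: re.
  have X0 : X = 0 by rewrite -[X]mulmx1 -eB mulmxA Xe mul0mx.
  by move: fX; rewrite X0 /row_free mxrank0.
apply: (sum3_split (Q := X) (Q' := Q') QQ (idempotent_bases ee)) => //.
- by rewrite mulmx_base /e addrC subrK.
- have -> : X *m A *m Q' = C by rewrite XA -mulmxA QQ mulmx1.
  (* [C] is [A] in the basis [X], which is a Krylov family: the first basis vector is cyclic for
     [C], with identity Krylov matrix. *)
  apply: (@cyclic_sum3 _ _ (delta_mx 0 ord0)) => //.
  apply/row_freeP; exists 1%:M; rewrite mulmx1; apply/row_matrixP=> i.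
  rewrite rowK row1; apply: (row_free_inj fX).
  rewrite /= -mulmxA -XAn mulmxA -!rowE !rowK; congr (_ *m _).
  by rewrite expr0 mulmx1.
- exact: IHn.
Qed.

Lemma sum3_all n (A : 'M[F]_n) :
  (forall x : F, [\/ x = 0, x = 1 | x = 2]) -> sum_of_three_idempotents A.
Proof.
move=> F3; elim/ltn_ind: n A => -[|n] IH A.
  by exists 0, 0, 0; split; rewrite /is_idempotent [LHS]flatmx0 [RHS]flatmx0.
apply: (@krylov_sum3 _ A (delta_mx 0 0) 0 n.+1) => // [r B rn|]; first exact: IH.
apply/row_freeP; exists (delta_mx 0 0).
have -> : krylov A (delta_mx 0 0) 1 = delta_mx 0 0.
  by apply/row_matrixP=> i; rewrite rowK ord1 expr0 [LHS]mulmx1 row_id.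
by rewrite mul_delta_mx; apply/rowP=> i; rewrite !mxE ord1.
Qed.

(** * Traces of idempotents and identities between involutions *)

Lemma trace_idempotent n (e : 'M[F]_n) : is_idempotent e -> \tr e = (\rank e)%:R.
Proof.
move=> ee; apply: etrans (congr1 mxtrace (esym (mulmx_base e))) _.
by rewrite mxtrace_mulC idempotent_bases // mxtrace1.
Qed.

Lemma sum3_involutions n (A : 'M[F]_n) :
  sum_of_three_idempotents A ->
  exists g1 g2 g3 : 'M[F]_n, [/\ g1 *m g1 = 1%:M, g2 *m g2 = 1%:M,
    g3 *m g3 = 1%:M & g1 + g2 + g3 = 3%:M - 2 *: A].
Proof.
have inv (e : 'M[F]_n) : is_idempotent e -> (1%:M - 2 *: e) *m (1%:M - 2 *: e) = 1%:M.
  move=> ee; change (e *m e = e) in ee.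
  rewrite mulmxBl mul1mx -scalemxAl mulmxBr mulmx1 -scalemxAr ee.
  by apply/matrixP=> i j; rewrite !mxE; ring.
case=> e1 [e2 [e3 [/inv i1 /inv i2 /inv i3 ->]]].
exists (1%:M - 2 *: e1), (1%:M - 2 *: e2), (1%:M - 2 *: e3); split=> //.
by apply/matrixP=> i j; rewrite !mxE; ring.
Qed.

Section Involutions.

Variables (n : nat) (g1 g2 : 'M[F]_n).
Hypotheses (inv1 : g1 *m g1 = 1%:M) (inv2 : g2 *m g2 = 1%:M).

Lemma sqr_sum_involutions :
  (g1 + g2) *m (g1 + g2) = 2%:M + (g1 *m g2 + g2 *m g1).
Proof.
rewrite mulmxDl !mulmxDr inv1 inv2.
by apply/matrixP=> i j; rewrite !mxE; ring.
Qed.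

Lemma sqr_sum_involutions_comm :
  g1 *m ((g1 + g2) *m (g1 + g2)) = (g1 + g2) *m (g1 + g2) *m g1.
Proof.
rewrite sqr_sum_involutions mulmxDr mulmxDl mul_mx_scalar mul_scalar_mx.
by rewrite mulmxDr mulmxDl !mulmxA inv1 mul1mx -(mulmxA g2) inv1 mulmx1 [X in _ + X]addrC.
Qed.

Lemma sum_sub_involutions :
  (g1 + g2) *m (g1 - g2) = - ((g1 - g2) *m (g1 + g2)).
Proof.
rewrite mulmxDl mulmxBl !mulmxDr !mulmxN inv1 inv2.
by apply/matrixP=> i j; rewrite !mxE; ring.
Qed.

End Involutions.

(** * Sums of three involutions when 2 and 3 are nonzero *)

Section CharNot23.

Hypotheses (two_neq0 : 2 != 0 :> F) (three_neq0 : 3 != 0 :> F).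

(* h := g1 + 2 g2 is invertible and anticommutes with g1: compare determinants. *)
Lemma involutions_sum0_even n (g1 g2 g3 : 'M[F]_n) :
  g1 *m g1 = 1%:M -> g2 *m g2 = 1%:M -> g3 *m g3 = 1%:M ->
  g1 + g2 + g3 = 0 -> ~~ odd n.
Proof.
move=> i1 i2 i3 s0.
have z : g1 *m g2 + g2 *m g1 = (- 1)%:M.
  have w : g1 + g2 = - g3 by apply/eqP; rewrite -addr_eq0 s0.
  have := sqr_sum_involutions i1 i2; rewrite w mulmxN mulNmx opprK i3 => e.
  rewrite -[LHS](addKr 2%:M) -e.
  by apply/matrixP=> i j; rewrite !mxE; ring.
(* The coefficient 2 makes [g1 *m h + h *m g1] equal to 2 + 2(-1) = 0. *)
pose h := g1 + 2 *: g2.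
have hh : h *m h = 3%:M.
  have -> : 3%:M = 1%:M + 2 *: (g1 *m g2 + g2 *m g1) + 4 *: 1%:M :> 'M_n.
    by rewrite z; apply/matrixP=> i j; rewrite !mxE; ring.
  rewrite /h mulmxDl !mulmxDr -!scalemxAl -!scalemxAr i1 i2.
  by apply/matrixP=> i j; rewrite !mxE; ring.
have gh : g1 *m h = (- 1) *: (h *m g1).
  apply/eqP; rewrite scaleN1r -addr_eq0.
  have -> : g1 *m h + h *m g1 = 2%:M + 2 *: (g1 *m g2 + g2 *m g1).
    rewrite /h mulmxDl mulmxDr -scalemxAl -scalemxAr i1.
    by apply/matrixP=> i j; rewrite !mxE; ring.
  by rewrite z; apply/eqP/matrixP=> i j; rewrite !mxE; ring.
have d1 : \det g1 != 0.
  by apply: contraTneq (oner_neq0 F) => d0; rewrite negbK -(det1 F n) -i1 det_mulmx d0 mul0r.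
have dh : \det h != 0.
  have : \det (h *m h) != 0 by rewrite hh det_scalar expf_neq0.
  by rewrite det_mulmx mulf_eq0 negb_or => /andP[].
apply/negP=> on; have := congr1 determinant gh.
rewrite detZ !det_mulmx (mulrC (\det h)) -signr_odd on expr1 mulN1r.
move/eqP; rewrite -addr_eq0 -mulr2n -mulr_natl !mulf_eq0.
by rewrite (negPf two_neq0) (negPf d1) (negPf dh).
Qed.

(* w := g1 + g2 anticommutes with d := g1 - g2, and w^2 is a polynomial of degree 1
   in w, so that d commutes with w as well. *)
Lemma scalar4_not_sum3 n : 5 != 0 :> F -> (0 < n)%N ->
  ~ sum_of_three_idempotents (4%:M : 'M[F]_n).
Proof.
move=> five_neq0 n0 /sum3_involutions[g1 [g2 [g3 [i1 i2 i3 s]]]].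
have [w wE] : exists w, w = g1 + g2 by exists (g1 + g2).
have [d dE] : exists d, d = g1 - g2 by exists (g1 - g2).
rewrite -wE in s.
have scal0 (c : F) : c%:M = 0 :> 'M_n -> c = 0.
  by move/matrixP/(_ (Ordinal n0) (Ordinal n0)); rewrite !mxE eqxx mulr1n.
have neq0 : 20 != 0 :> F /\ 384 != 0 :> F.
  have -> : 20 = 2 * 2 * 5 :> F by ring.
  have -> : 384 = 2 ^+ 7 * 3 :> F by ring.
  by rewrite !mulf_neq0 ?expf_neq0.
(* Here 3 - 2 * 4 = -5, so [w] is -5 - [g3] and its square is 26 + 10 [g3]. *)
have ww : w *m w = (- 24)%:M - 10 *: w.
  have -> : w = (- 5)%:M - g3.
    by rewrite -[LHS](addrK g3) s; apply/matrixP=> i j; rewrite !mxE; ring.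
  rewrite mulmxBl !mulmxBr !mul_scalar_mx mul_mx_scalar i3.
  by apply/matrixP=> i j; rewrite !mxE; ring.
have wd : w *m d = - (d *m w)  by rewrite wE dE sum_sub_involutions.
have dw : d *m w = - (w *m d) by rewrite wd opprK.
(* [d] commutes with w^2 = -24 - 10 w, hence 10 w d = 10 d w = -10 w d. Then 0 = w^2 d = -24 d gives
   [g1 = g2], so w^2 = 4 and 10 w = -28; squaring the latter leaves 784 = 400. *)
have wd0 : w *m d = 0.
  have : w *m (w *m d) = d *m (w *m w).
    by rewrite (mulmxA d w w) dw mulNmx -(mulmxA w d w) dw mulmxN opprK.
  rewrite mulmxA ww mulmxBl mulmxBr mul_scalar_mx mul_mx_scalar -scalemxAl -scalemxAr.
  move/addrI/oppr_inj/eqP; rewrite wd -subr_eq0 -scalerBr -opprD scalerN oppr_eq0.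
  rewrite -mulr2n -scaler_nat scalerA -natrM scaler_eq0 (negPf neq0.1) /=.
  by move/eqP->; rewrite oppr0.
have d0 : d = 0.
  have : w *m (w *m d) = 0 by rewrite wd0 mulmx0.
  rewrite mulmxA ww mulmxBl mul_scalar_mx -scalemxAl wd0 scaler0 subr0 => /eqP.
  rewrite scaler_eq0 oppr_eq0 => /orP[|/eqP//].
  have -> : 24 = 2 * 2 * 2 * 3 :> F by ring.
  by rewrite !mulf_eq0 (negPf two_neq0) (negPf three_neq0).
have w2 : w = 2 *: g1.
  by rewrite wE -(subrK g2 g1) -dE d0 add0r -mulr2n scaler_nat.
have w4 : w *m w = 4%:M.
  rewrite w2 -scalemxAl -scalemxAr i1 scalerA -natrM.
  by apply/matrixP=> i j; rewrite !mxE; ring.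
have w28 : 10 *: w = (- 28)%:M.
  have := ww; rewrite w4 => /eqP; rewrite eq_sym subr_eq => /eqP e.
  rewrite -[LHS](addKr 4%:M) -e.
  by apply/matrixP=> i j; rewrite !mxE; ring.
suff e384 : 384%:M = 0 :> 'M[F]_n by move/eqP: (scal0 _ e384); apply/negP; exact: neq0.2.
have : (10 *: w) *m (10 *: w) = 400%:M.
  rewrite -scalemxAl -scalemxAr w4.
    by apply/matrixP=> i j; rewrite !mxE; ring.
rewrite w28 -scalar_mxM => e.
have -> : 384 = (- 28) * (- 28) - 400 :> F by ring.
by rewrite raddfB /= e subrr.
Qed.

(* The three involutions induce on the row kernel of u, of dimension n - 1,
   involutions of sum 0. *)
Lemma involutions_rank1_eigen_all n (g1 g2 g3 : 'M[F]_n) (u : 'cV_n) (v : 'rV_n) c1 c2 c3 :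
  g1 *m g1 = 1%:M -> g2 *m g2 = 1%:M -> g3 *m g3 = 1%:M ->
  v *m u = 1%:M -> g1 + g2 + g3 = u *m v ->
  g1 *m u = c1 *: u -> g2 *m u = c2 *: u -> g3 *m u = c3 *: u -> odd n.
Proof.
move=> i1 i2 i3 vu s e1 e2 e3.
pose K := row_base (kermx u).
have fK : row_free K := row_base_free _.
have Ku : K *m u = 0 by apply/sub_kermxP; rewrite eq_row_base.
have stab (g : 'M_n) c : g *m g = 1%:M -> g *m u = c *: u ->
    exists2 G, G *m G = 1%:M & K *m g = G *m K.
  move=> ig eg; have /submxP[G KG] : (K *m g <= K)%MS.
    rewrite (eq_row_base (kermx u)); apply/sub_kermxP.
    by rewrite -mulmxA eg -scalemxAr Ku scaler0.
  exists G => //; apply: (row_free_inj fK).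
  by rewrite /= -mulmxA -KG mulmxA -KG -mulmxA ig mulmx1 mul1mx.
have [G1 I1 K1] := stab _ _ i1 e1.
have [G2 I2 K2] := stab _ _ i2 e2.
have [G3 I3 K3] := stab _ _ i3 e3.
have G0 : G1 + G2 + G3 = 0.
  apply: (row_free_inj fK).
  by rewrite /= !mulmxDl -K1 -K2 -K3 -!mulmxDr s mulmxA Ku !mul0mx.
have ru : \rank u = 1%N.
  apply/eqP; rewrite -mxrank_tr; apply/row_freeP; exists v^T.
  by rewrite -trmx_mul vu trmx1.
have n_gt0 : (0 < n)%N by rewrite -ru rank_leq_row.
by have := involutions_sum0_even I1 I2 I3 G0; rewrite mxrank_ker ru; lia.
Qed.

(* Here (g1 + g2)^2 - 1 has the form u y and commutes with g1 and g2. *)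
Lemma involutions_rank1_eigen n (g1 g2 g3 : 'M[F]_n) (u : 'cV_n) (v : 'rV_n) c :
  g1 *m g1 = 1%:M -> g2 *m g2 = 1%:M -> g3 *m g3 = 1%:M ->
  v *m u = 1%:M -> g1 + g2 + g3 = u *m v ->
  g3 *m u = c *: u -> odd n.
Proof.
move=> i1 i2 i3 vu s e3.
have wE : g1 + g2 = u *m v - g3 by rewrite -s addrK.
pose y := (1 - c) *: v - v *m g3.
have PE : (g1 + g2) *m (g1 + g2) = 1%:M + u *m y.
  rewrite wE /y mulmxBl !mulmxBr i3 !mulmxA e3 -(mulmxA u v u) vu mulmx1.
  rewrite -scalemxAr -scalemxAl scalerBl scale1r.
  by apply/matrixP=> i j; rewrite !mxE; ring.
have c2 : c * c = 1.
  have : v *m (g3 *m g3 *m u) = (c * c)%:M.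
    by rewrite -mulmxA e3 -scalemxAr e3 -!scalemxAr vu scalerA scalemx1.
  by rewrite i3 mul1mx vu => /matrixP/(_ 0 0); rewrite !mxE.
have yu : y *m u = (1 - 2 * c)%:M.
  rewrite mulmxBl -scalemxAl vu -mulmxA e3 -scalemxAr vu -scalerBl scalemx1.
  by congr _%:M; ring.
(* Otherwise (2c)^2 = 1, while c^2 = 1 makes it 4. *)
have k0 : 1 - 2 * c != 0.
  apply: contraNneq three_neq0 => k0; apply/eqP.
  have : 2 * c * (2 * c) = 1.
    by have /eqP := k0; rewrite subr_eq0 eq_sym => /eqP->; ring.
  rewrite mulrACA c2 => k1; rewrite -[3](addrK 1) -[X in _ - X]k1.
  by ring.
(* Applying g u y = u y g to [u] gives (y u) g u = (y g u) u, where y u = 1 - 2c is invertible. *)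
have eig (g : 'M_n) : g *m ((g1 + g2) *m (g1 + g2)) = (g1 + g2) *m (g1 + g2) *m g ->
    exists b, g *m u = b *: u.
  rewrite PE mulmxDr mulmxDl mulmx1 mul1mx => /addrI/(congr1 (mulmx^~ u)).
  rewrite -!mulmxA yu mulmxA mul_mx_scalar [y *m _]mx11_scalar mul_mx_scalar => e.
  exists ((1 - 2 * c)^-1 * (y *m (g *m u)) 0 0).
  by rewrite -scalerA -e scalerA mulVf // scale1r.
have [b1 e1] := eig _ (sqr_sum_involutions_comm i1 i2).
have [|b2 e2] := eig g2; first by rewrite addrC; exact: sqr_sum_involutions_comm.
exact: involutions_rank1_eigen_all i1 i2 i3 vu s e1 e2 e3.
Qed.

(* If neither u nor v is an eigenvector of any of the g's, then v and v g3 span a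
   plane on which the g's act with trace 0, while u v acts with trace 1. *)
Lemma involutions_rank1_odd n (g1 g2 g3 : 'M[F]_n) (u : 'cV_n) (v : 'rV_n) :
  g1 *m g1 = 1%:M -> g2 *m g2 = 1%:M -> g3 *m g3 = 1%:M ->
  v *m u = 1%:M -> g1 + g2 + g3 = u *m v -> odd n.
Proof.
move=> i1 i2 i3 vu s; apply: contraT => even_n.
have s1 : g2 + g3 + g1 = u *m v by rewrite -s [LHS]addrC addrA.
have s2 : g3 + g1 + g2 = u *m v by rewrite -s1 [LHS]addrC addrA.
have trI (g : 'M[F]_n) : g *m g = 1%:M -> g^T *m g^T = 1%:M.
  by move=> ig; rewrite -trmx_mul ig trmx1.
(* Transposition exchanges the roles of [u] and [v]. *)
have left_eigen (h1 h2 h3 : 'M[F]_n) c :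
    h1 *m h1 = 1%:M -> h2 *m h2 = 1%:M -> h3 *m h3 = 1%:M ->
    h1 + h2 + h3 = u *m v -> v *m h3 <> c *: v.
  move=> j1 j2 j3 t e; move/negP: even_n; apply.
  apply: (involutions_rank1_eigen (c := c) (u := v^T) (v := u^T) (trI _ j1) (trI _ j2) (trI _ j3)).
  - by rewrite -trmx_mul vu trmx1.
  - by rewrite -trmx_mul -t !linearD.
  - by rewrite -trmx_mul e linearZ.
set q := v *m g3.
have indep x y : x *: v + y *: q = 0 -> x = 0 /\ y = 0.
  move=> xy; have y0 : y = 0.
    apply/eqP; apply: contraT => y0; case: (left_eigen _ _ _ (- y^-1 * x) i1 i2 i3 s).
    move/eqP: xy; rewrite addrC addr_eq0 => /eqP xy.
    by rewrite -/q -[q]scale1r -(mulVf y0) -scalerA xy scalerN scalerA mulNr scaleNr.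
  split=> //; move/(congr1 (mulmx^~ u)): xy.
  rewrite y0 scale0r addr0 mul0mx -scalemxAl vu => /matrixP/(_ 0 0).
  by rewrite !mxE mulr1.
have [i k0] : exists i, (g3 *m u - u *m (v *m (g3 *m u))) i 0 != 0.
  apply/existsP; apply: contraT; rewrite negb_exists => /forallP k0.
  have /negP[] := even_n.
  apply: (involutions_rank1_eigen (c := (v *m (g3 *m u)) 0 0) i1 i2 i3 vu s).
  rewrite -mul_mx_scalar -mx11_scalar; apply/eqP; rewrite -subr_eq0; apply/eqP/colP=> i.
  by rewrite [RHS]mxE; apply/eqP/negPn/k0.
set k := (X in X != 0) in k0.
(* [l] kills [u] but not [g3 *m u]; multiplying the commutation relation by [l] on the left isolates
   [v *m g]. *)
pose l := delta_mx 0 i *m (1%:M - u *m v) : 'rV_n.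
have lu : l *m u = 0 by rewrite -mulmxA mulmxBl mul1mx -mulmxA vu mulmx1 subrr mulmx0.
have lgu : l *m g3 *m u = k%:M.
  rewrite -!mulmxA mulmxBl mul1mx -mulmxA [LHS]mx11_scalar -rowE; congr _%:M.
  by rewrite mxE.
have [r rE] : exists r, r = v - q by exists (v - q).
have PE : (g1 + g2) *m (g1 + g2) = 1%:M + (u *m r - g3 *m u *m v).
  have -> : g1 + g2 = u *m v - g3 by rewrite -s addrK.
  rewrite rE mulmxBl !mulmxBr i3 !mulmxA -(mulmxA u v u) vu mulmx1.
  by apply/matrixP=> a b; rewrite !mxE; ring.
have vg (g : 'M_n) : g *m ((g1 + g2) *m (g1 + g2)) = (g1 + g2) *m (g1 + g2) *m g ->
    exists a b, v *m g = a *: v + b *: q.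
  rewrite PE mulmxDr mulmxDl mulmx1 mul1mx => /addrI/(congr1 (mulmx l)).
  rewrite mulmxBl !mulmxBr !mulmxA lu !mul0mx sub0r lgu.
  rewrite [l *m g *m u]mx11_scalar [l *m g *m g3 *m u]mx11_scalar !mul_scalar_mx.
  set a := _ 0 0; set b := _ 0 0 => e.
  exists (- k^-1 * (a - b)), (k^-1 * a).
  have e' : k *: (v *m g) = b *: v - a *: r.
    by rewrite -[LHS]opprK scalemxAl -e opprB.
  rewrite -[LHS]scale1r -(mulVf k0) -scalerA e' rE.
  by apply/matrixP=> x y; rewrite !mxE; ring.
(* From v g = a v + b q and v g^2 = v, with [b] nonzero, the coefficient of [q] in [q *m g] is
   [- a]: trace 0 on the plane. *)
have qg (h2 h3 g : 'M_n) a b : g *m g = 1%:M -> h2 *m h2 = 1%:M -> h3 *m h3 = 1%:M ->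
    h2 + h3 + g = u *m v -> v *m g = a *: v + b *: q ->
    exists c, q *m g = c *: v - a *: q.
  move=> ig j2 j3 t vgE; have b0 : b != 0.
    apply/eqP=> b0; apply: (left_eigen h2 h3 g a) => //.
    by rewrite vgE b0 scale0r addr0.
  exists (b^-1 * (1 - a * a)).
  have : v *m g *m g = v by rewrite -mulmxA ig mulmx1.
  rewrite {1}vgE mulmxDl -!scalemxAl vgE => e.
  have {}e : b *: (q *m g) = v - a *: (a *: v + b *: q) by apply/eqP; rewrite eq_sym subr_eq addrC e.
  rewrite -[LHS]scale1r -(mulVf b0) -scalerA e.
  apply/matrixP=> x y; rewrite !mxE.
  by field.
have [a1 [b1 v1]] := vg _ (sqr_sum_involutions_comm i1 i2).
have [|a2 [b2 v2]] := vg g2; first by rewrite addrC; exact: sqr_sum_involutions_comm.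
have [c1 q1] := qg _ _ _ _ _ i1 i2 i3 s1 v1.
have [c2 q2] := qg _ _ _ _ _ i2 i3 i1 s2 v2.
(* The [v] coefficient of v(g1 + g2 + g3) = v gives a1 + a2 = 1; below, the [q] coefficient of q(g1
   + g2 + g3) = (q u) v gives a1 + a2 = 0. *)
have [a12 _] : a1 + a2 - 1 = 0 /\ b1 + b2 + 1 = 0.
  apply: indep; have : v *m (g1 + g2 + g3) = v by rewrite s mulmxA vu mul1mx.
  rewrite !mulmxDr v1 v2 -/q => e; rewrite -[RHS](subrr v) -[X in _ = X - _]e.
  by apply/matrixP=> x y; rewrite !mxE; ring.
have [_ a21] : c1 + c2 + 1 - (q *m u) 0 0 = 0 /\ - (a1 + a2) = 0.
  apply: indep; have : q *m (g1 + g2 + g3) = (q *m u) 0 0 *: v.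
    by rewrite s mulmxA {1}[q *m u]mx11_scalar mul_scalar_mx.
  rewrite !mulmxDr q1 q2 -mulmxA i3 mulmx1 => e.
  rewrite -[RHS](subrr ((q *m u) 0 0 *: v)) -[X in _ = X - _]e.
  by apply/matrixP=> x y; rewrite !mxE; ring.
have /negP[] := oner_neq0 F.
have -> : 1 = - (a1 + a2 - 1) - - (a1 + a2) :> F by ring.
by rewrite a12 a21 !oppr0 addr0.
Qed.

End CharNot23.

(** * From invertible matrices to the characteristic and the elements of the field *)

Section Reflections.

Variable n : nat.
Let E : 'M[F]_n.+1 := delta_mx 0 0.

Lemma delta00_idem : E *m E = E.
Proof. by rewrite mul_delta_mx. Qed.

Lemma unitmx_add_delta00 (a : F) : a != 0 -> 1%:M + (a - 1) *: E \in unitmx.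
Proof.
move=> a0; suff /mulmx1_unit[] : (1%:M + (a - 1) *: E) *m (1%:M + (a^-1 - 1) *: E) = 1%:M by [].
rewrite mulmxDl mul1mx mulmxDr mulmx1 -scalemxAl -scalemxAr delta00_idem.
by apply/matrixP=> i j; rewrite !mxE; field.
Qed.

Lemma trace_delta00 : \tr E = 1.
Proof.
by rewrite /mxtrace (bigD1 0) //= big1 ?addr0 => [|i /negPf i0]; rewrite mxE ?i0 ?eqxx.
Qed.

End Reflections.

(* 4 I works for characteristics other than 2, 3 and 5.  In characteristic 5, so do
   - I when n is odd and diag(1, -1, ..., -1) when n is even. *)
Lemma char23_of_unit_sum3 n : (0 < n)%N ->
  (forall A : 'M[F]_n, A \in unitmx -> sum_of_three_idempotents A) ->
  2 = 0 :> F \/ 3 = 0 :> F.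
Proof.
case: n => // n _ H.
have [|two0] := eqVneq (2 : F) 0; first by left.
have [|three0] := eqVneq (3 : F) 0; first by right.
exfalso; have [five0|five0] := eqVneq (5 : F) 0; last first.
  apply: (scalar4_not_sum3 two0 three0 five0 (ltn0Sn n)); apply: H.
  rewrite unitmxE det_scalar unitfE expf_neq0 //.
  have -> : 4 = 2 * 2 :> F by ring.
  exact: mulf_neq0.
have [odd_n|even_n] := boolP (odd n.+1).
  have [|g1 [g2 [g3 [i1 i2 i3 s]]]] := @sum3_involutions n.+1 (- 1)%:M.
    by apply: H; rewrite unitmxE det_scalar unitfE expf_neq0 ?oppr_eq0 ?oner_neq0.
  have : g1 + g2 + g3 = 0.
    rewrite s scale_scalar_mx -raddfB /= (_ : 3 - 2 * -1 = 5 :> F); last by ring.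
    by rewrite five0 raddf0.
  by move/(involutions_sum0_even two0 three0 i1 i2 i3); rewrite odd_n.
pose E : 'M[F]_n.+1 := delta_mx 0 0.
(* This is diag(1, -1, ..., -1), minus the matrix diag(-1, 1, ..., 1). As 5 = 0, the involutions add
   up to [E], of rank 1. *)
have [|g1 [g2 [g3 [i1 i2 i3 s]]]] := @sum3_involutions n.+1 (- 1%:M - (- 1 - 1) *: E).
  apply: H; rewrite -opprD -scaleN1r unitmxZ ?unitrN1 //.
  by apply: unitmx_add_delta00; rewrite oppr_eq0 oner_neq0.
apply/(negP even_n)/(involutions_rank1_odd two0 three0 (u := delta_mx 0 0) (v := delta_mx 0 0) i1 i2 i3).
  by rewrite mul_delta_mx; apply/matrixP=> i j; rewrite !mxE !ord1.
rewrite s mul_delta_mx -/E.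
rewrite [RHS](_ : E = 5 *: (1%:M - E) + E); last by rewrite five0 scale0r add0r.
by apply/matrixP=> i j; rewrite !mxE; ring.
Qed.

Lemma field_elements_of_unit_sum3 n : (0 < n)%N ->
  (forall A : 'M[F]_n, A \in unitmx -> sum_of_three_idempotents A) ->
  forall x : F, [\/ x = 0, x = 1 | x = 2].
Proof.
move=> n0 H x; have c23 := char23_of_unit_sum3 n0 H.
have nat012 k : [\/ k%:R = 0 :> F, k%:R = 1 :> F | k%:R = 2 :> F].
  elim: k => [|k IH]; first by apply: Or31.
  rewrite -(natr1 k); case: IH => ->; [by apply: Or32; rewrite add0r | by apply: Or33 |].
  by case: c23 => e; [apply: Or32; rewrite e add0r | apply: Or31; rewrite -[RHS]e; ring].
have [->|x0] := eqVneq x 0; first exact: Or31.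
case: n n0 H => // n _ H.
have [e1 [e2 [e3 [i1 i2 i3 /(congr1 mxtrace)]]]] := H _ (unitmx_add_delta00 n x0).
rewrite !linearD linearZ /= mxtrace1 trace_delta00 !trace_idempotent // -!natrD.
set r := (_ + _ + _)%N => e.
have xE : x = r%:R - n%:R by rewrite -e -natr1; ring.
(* The sign is absorbed: -n is n in characteristic 2 and 2n in characteristic 3. *)
case: c23 => p0.
  have -> : x = (r + n)%:R by rewrite xE -[RHS]subr0 -(mul0r n%:R) -p0 natrD; ring.
  exact: nat012.
have -> : x = (r + n + n)%:R by rewrite xE -[RHS]subr0 -(mul0r n%:R) -p0 !natrD; ring.
exact: nat012.
Qed.

(** * Fields whose elements are 0, 1 and 2 *)

Lemma isomorphic_of_char2 : 2 = 0 :> F ->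
  (forall x : F, [\/ x = 0, x = 1 | x = 2]) -> ring_isomorphic F 'Z_2.
Proof.
move=> p0 F3; have F2 (x : F) : x = 0 \/ x = 1 by case: (F3 x) => ->; rewrite ?p0; tauto.
pose f (x : F) : 'Z_2 := (x != 0)%:R.
have f0 : f 0 = 0 by rewrite /f eqxx.
have f1 : f 1 = 1 by rewrite /f oner_neq0.
have fA : {morph f : x y / x + y}.
  move=> x y; case: (F2 x) => ->; first by rewrite f0 !add0r.
  case: (F2 y) => ->; first by rewrite f0 !addr0.
  by rewrite (_ : 1 + 1 = 0) // f0 f1; apply/val_inj.
have fM : {morph f : x y / x * y}.
  move=> x y; case: (F2 x) => ->; first by rewrite mul0r f0 mul0r.
  by rewrite f1 !mul1r.
pose fadd := GRing.isNmodMorphism.Build F 'Z_2 f (conj f0 fA).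
pose fmul := GRing.isMonoidMorphism.Build F 'Z_2 f (conj f1 fM).
pose g : {rmorphism F -> 'Z_2} := HB.pack f fadd fmul.
exists g; exists (fun y : 'Z_2 => (y : nat)%:R) => [x|y].
  by change ((f x : nat)%:R = x); case: (F2 x) => ->; rewrite ?f0 ?f1.
change (f (y : nat)%:R = y).
by case: y => -[|[|]] // lt; apply: val_inj; rewrite /= ?f0 ?f1.
Qed.

Lemma isomorphic_of_char3 : 3 = 0 :> F ->
  (forall x : F, [\/ x = 0, x = 1 | x = 2]) -> ring_isomorphic F 'Z_3.
Proof.
move=> p0 F3.
have n2 : 2 != 0 :> F.
  by apply: contra_neq (oner_neq0 F) => e; rewrite (_ : 1 = 3 - 2 :> F); [rewrite p0 e subrr | ring].
have n21 : 2 != 1 :> F.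
  by apply: contra_neq (oner_neq0 F) => e; rewrite (_ : 1 = 2 - 1 :> F); [rewrite e subrr | ring].
pose f (x : F) : 'Z_3 := if x == 0 then 0 else if x == 1 then 1 else 2.
have f0 : f 0 = 0 by rewrite /f eqxx.
have f1 : f 1 = 1 by rewrite /f oner_eq0 eqxx.
have f2 : f 2 = 2 by rewrite /f (negPf n2) (negPf n21).
have e3 : 1 + 2 = 0 :> F by rewrite -p0; ring.
have e3' : 2 + 1 = 0 :> F by rewrite -p0; ring.
have e4 : 2 + 2 = 1 :> F by rewrite -[RHS]addr0 -p0; ring.
have e4' : 2 * 2 = 1 :> F by rewrite -[RHS]addr0 -p0; ring.
have fA : {morph f : x y / x + y}.
  move=> x y; case: (F3 x) => ->; first by rewrite f0 !add0r.
    case: (F3 y) => ->; first by rewrite f0 !addr0.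
      by rewrite (_ : 1 + 1 = 2 :> F) // f1 f2.
    by rewrite e3 f0 f1 f2; exact: val_inj.
  by case: (F3 y) => ->; rewrite ?e3' ?e4 ?f0 ?f1 ?f2 ?addr0 ?f2 //; exact: val_inj.
have fM : {morph f : x y / x * y}.
  move=> x y; case: (F3 x) => ->; first by rewrite mul0r f0 mul0r.
    by rewrite f1 !mul1r.
  by case: (F3 y) => ->; rewrite ?mulr0 ?mulr1 ?e4' ?f0 ?f1 ?f2 ?mulr0 ?mulr1 //; exact: val_inj.
pose fadd := GRing.isNmodMorphism.Build F 'Z_3 f (conj f0 fA).
pose fmul := GRing.isMonoidMorphism.Build F 'Z_3 f (conj f1 fM).
pose g : {rmorphism F -> 'Z_3} := HB.pack f fadd fmul.
exists g; exists (fun y : 'Z_3 => (y : nat)%:R) => [x|y].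
  by change ((f x : nat)%:R = x); case: (F3 x) => ->; rewrite ?f0 ?f1 ?f2.
change (f (y : nat)%:R = y).
by case: y => -[|[|[|]]] // lt; apply: val_inj; rewrite /= ?f0 ?f1 ?f2.
Qed.

(** Elements of the target are images of natural numbers below 2 or 3, and an injective morphism
    reflects this. *)
Lemma field_elements_of_isomorphic :
  ring_isomorphic F 'Z_2 \/ ring_isomorphic F 'Z_3 ->
  forall x : F, [\/ x = 0, x = 1 | x = 2].
Proof.
have nat_of p (f : {rmorphism F -> 'Z_p}) x k : bijective f -> f x = k%:R -> x = k%:R.
  by move=> /bij_inj fI e; apply: fI; rewrite e rmorph_nat.
case=> -[f bf] x.
  have := nat_of _ f x (f x) bf; rewrite natr_Zp => /(_ erefl).
  by case: (f x) => -[|[|]] //= _ ->; [apply: Or31 | apply: Or32].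
have := nat_of _ f x (f x) bf; rewrite natr_Zp => /(_ erefl).
by case: (f x) => -[|[|[|]]] //= _ ->; [apply: Or31 | apply: Or32 | apply: Or33].
Qed.

End SumOfThree.

Theorem theorem1p1 (F : fieldType) (n : nat) (n_ge1 : (1 <= n)%N) :
  ((forall A : 'M[F]_n, sum_of_three_idempotents A) <->
   (forall A : 'M[F]_n, A \in unitmx -> sum_of_three_idempotents A))
  /\
  ((forall A : 'M[F]_n, A \in unitmx -> sum_of_three_idempotents A) <->
   (ring_isomorphic F 'Z_2 \/ ring_isomorphic F 'Z_3)).
Proof.
(* Everything passes through the condition that each element of [F] is 0, 1 or 2. *)
have units_all : (forall A : 'M[F]_n, A \in unitmx -> sum_of_three_idempotents A) ->
    forall A : 'M[F]_n, sum_of_three_idempotents A.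
  by move=> H A; apply: sum3_all; exact: field_elements_of_unit_sum3 n_ge1 H.
split; first by split=> [H A _|/units_all].
split=> [H|/field_elements_of_isomorphic F3 A _]; last exact: sum3_all.
have F3 := field_elements_of_unit_sum3 n_ge1 H.
by case: (char23_of_unit_sum3 n_ge1 H) => p0;
  [left; exact: isomorphic_of_char2 | right; exact: isomorphic_of_char3].
Qed.
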